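(* Let $G$ be a group with a finite symmetric choice of generators $X$. Then the following are equivalent: (i) $G$ is amenable; (ii) $\gamma^{G,X}=|X|$; (iii) $\lambda^{G,X}_g=|X|$ for some $g\in G$; (iv) $\lambda^{G,X}_g=|X|$ for all $g\in G$.
   Context: A finite choice of generators for $G$ (as a semigroup) is a finite set $X$ of symbols together with a surjective morphism $X^+\to G$, $w\mapsto\overline{w}$, from the free semigroup on $X$ (several symbols may map to the same element). It is symmetric if for every $g\in G$ the same number (possibly $0$) of symbols in $X$ represent $g$ and $g^{-1}$. $|w|$ is the length of a word $w$. For $g\in G$ the local cogrowth function $\lambda^{G,X}_g(n)$ ($n\geq1$) is the number of words of length $n$ in $X^+$ representing $g$, and the local cogrowth rate at $g$ is $\lambda^{G,X}_g=\limsup_{n\to\infty}(\lambda^{G,X}_g(n))^{1/n}$. The global cogrowth function $\gamma^{G,X}(n)$ is the number of pairs $(u,v)$ of non-empty words over $X$ with $|u|+|v|=n$ and $\overline{u}=\overline{v}$, and the global cogrowth rate is $\gamma^{G,X}=\limsup_{n\to\infty}(\gamma^{G,X}(n))^{1/n}$. Amenability of the (discrete) group $G$ is the usual notion: there is a finitely additive, translation-invariant probability measure defined on all subsets of $G$. *)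

(* Defs.v *)
From HB Require Import structures.
From mathcomp Require Import all_boot all_order all_algebra finmap.
From mathcomp Require Import all_classical all_reals all_analysis.

Set Implicit Arguments.
Unset Strict Implicit.
Unset Printing Implicit Defensive.

Import Order.TTheory GRing.Theory Num.Theory.

Local Open Scope classical_set_scope.
Local Open Scope ring_scope.

(* [word X] is the free semigroup X^+: the empty word is excluded. *)
Record word (X : finType) := Word {
  letters :> seq X;
  letters_neq0 : letters != [::] }.

HB.instance Definition _ (X : finType) := [isSub for @letters X].
HB.instance Definition _ (X : finType) := [Choice of word X by <:].

Lemma cat_neq0 (X : finType) (u v : word X) : letters u ++ letters v != [::].
Proof. by case: u => -[]. Qed.

Definition word_cat (X : finType) (u v : word X) : word X :=
  Word (cat_neq0 u v).

Lemma word_catA (X : finType) : associative (@word_cat X).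
Proof. by move=> u v w; apply/val_inj; rewrite /= catA. Qed.

HB.instance Definition _ (X : finType) := isSemigroup.Build (word X) (@word_catA X).

Lemma letter_neq0 (X : finType) (x : X) : [:: x] != [::].
Proof. by []. Qed.

Definition letter (X : finType) (x : X) : word X := Word (letter_neq0 x).

Definition symmetric_choice (G : groupType) (X : finType)
    (ev : {multiplicative word X -> G}) : Prop :=
  forall g : G,
    #|[set x : X | ev (letter x) == g]%SET|
    = #|[set x : X | ev (letter x) == (g^-1)%g]%SET|.

Definition local_words (G : groupType) (X : finType)
    (ev : {multiplicative word X -> G}) (g : G) (n : nat) : set (word X) :=
  [set w : word X | size w = n /\ ev w = g].

Definition global_pairs (G : groupType) (X : finType)
    (ev : {multiplicative word X -> G}) (n : nat) : set (word X * word X) :=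
  [set uv : word X * word X | (size uv.1 + size uv.2)%N = n /\ ev uv.1 = ev uv.2].

(* [fset_set] sends infinite sets to the empty one; the next lemmas show that
   this case does not arise in the cogrowth functions. *)
Lemma finite_short_words (X : finType) (n : nat) :
  finite_set [set w : word X | (size w <= n)%N].
Proof.
apply: (@sub_finite_set _ _
  (\bigcup_(m in `I_n.+1) [set w : word X | size w = m])).
  by move=> w /= wn; exists (size w).
apply: bigcup_finite; first exact: finite_II.
move=> m _; have /finite_preimage : finite_set (range (@tval m X)).
  exact/finite_image/finite_finset.
move=> /(_ _ (@letters X)) /(_ (in2W (@val_inj _ _ (word X)))).
by apply: sub_finite_set => w /= /eqP wm; exists (Tuple wm).
Qed.

Lemma finite_local_words (G : groupType) (X : finType)
    (ev : {multiplicative word X -> G}) (g : G) (n : nat) :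
  finite_set (local_words ev g n).
Proof.
by apply: sub_finite_set (@finite_short_words X n) => w [/= <- _].
Qed.

Lemma finite_global_pairs (G : groupType) (X : finType)
    (ev : {multiplicative word X -> G}) (n : nat) :
  finite_set (global_pairs ev n).
Proof.
apply: sub_finite_set
  (finite_setX (@finite_short_words X n) (@finite_short_words X n)).
by move=> [u v] [/= <- _]; rewrite leq_addr leq_addl.
Qed.

Definition local_cogrowth (G : groupType) (X : finType)
    (ev : {multiplicative word X -> G}) (g : G) (n : nat) : nat :=
  #|` fset_set (local_words ev g n)|%fset.

Definition global_cogrowth (G : groupType) (X : finType)
    (ev : {multiplicative word X -> G}) (n : nat) : nat :=
  #|` fset_set (global_pairs ev n)|%fset.

(* The limsup is taken in the extended reals, where it always exists. *)
Definition growth_rate (R : realType) (a : nat -> nat) : \bar R :=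
  limn_esup (fun n => (((a n)%:R : R) `^ (n%:R^-1))%:E).

Definition local_cogrowth_rate (R : realType) (G : groupType) (X : finType)
    (ev : {multiplicative word X -> G}) (g : G) : \bar R :=
  growth_rate R (local_cogrowth ev g).

Definition global_cogrowth_rate (R : realType) (G : groupType) (X : finType)
    (ev : {multiplicative word X -> G}) : \bar R :=
  growth_rate R (global_cogrowth ev).

Definition amenable (R : realType) (G : groupType) : Prop :=
  exists mu : set G -> R,
    [/\ forall A, 0 <= mu A,
        mu setT = 1,
        forall A B, A `&` B = set0 -> mu (A `|` B) = mu A + mu B
      & forall (g : G) A, mu ((fun x => (g * x)%g) @` A) = mu A].

(* Main.v *)
Require Import Defs.
From mathcomp Require Import all_boot all_order all_algebra finmap.
From mathcomp Require Import all_classical all_reals all_analysis.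
From mathcomp Require Import ring lra zify.

(** Kesten's criterion. Write [d = #|X|], and let [walks n g] be the number of
    sequences of [n] letters whose product is [g], so that [walks n] is the
    [n]-fold convolution power of the counting measure of the letters.

    All the cogrowth rates coincide. Appending a fixed word to a word for [g]
    compares the local rates at two elements of [G]. The symmetry of the letters
    gives [walks n g^-1 = walks n g], so for a fixed [u] of length [k] there are as
    many [v] of length [n - k] with the value of [u] as with the inverse value,
    that is, with [u v] representing [1]. Hence [walks n 1] pairs are counted for
    each of the [n.-1] values of [k], and a factor [n] does not change a growth
    rate. It remains to see that [G] is amenable if and
    only if the growth rate [r] of [walks n 1] is [d].

    Amenable implies [r = d] ([amenable_kesten]). If [r < t < d], the Green
    function [u g = \sum_n walks n g / t ^ n] converges, is positive and
    satisfies [\sum_x u (x^-1 g) <= t * u g]. The quotients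
    [q_a g = u (a^-1 g) / u g] are bounded for [a] a letter and satisfy
    [q_a g * q_(a^-1) (a^-1 g) = 1], hence [q_a g + q_(a^-1) (a^-1 g) >= 2].
    Integrating against an invariant mean and summing over the letters, the
    integral of [\sum_x q_x] is at least [d]; but that function is at most [t].
    This avoids Folner sets and paradoxical decompositions. The mean is only
    integrated on functions with finitely many values ([mean_integral]), so
    [q_a] is replaced by the integer part of [N * q_a] for a large [N].

    Conversely, [r = d] implies amenable ([kesten_amenable]). The squared norm of
    [walks n] in [l^2(G)] is [a_n = walks (2n) 1]. Were [a_(n+1)] at most
    [s^2 * a_n] for every [n] and some [s < d], then [r <= s]; so [a_(n+1) / a_n]
    comes arbitrarily close to its maximal value [d^2]. For such an [n], the
    function [walks n] is almost fixed in [l^2] by the products of two letters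
    ([walks_dist2], [ratio_two_letters]), and the probability on [G] with density
    [walks n g ^ 2 / a_n] is almost fixed too ([walk_mean_translate]). A limit of
    these probabilities along an ultrafilter is a mean invariant under products
    of two letters; averaging it with its translate by one letter makes it
    invariant under every letter, hence under [G] ([amenable_of_invariant]). *)

Set Implicit Arguments.
Unset Strict Implicit.
Unset Printing Implicit Defensive.

Import Order.TTheory GRing.Theory Num.Theory.
Import numFieldNormedType.Exports.

Local Open Scope classical_set_scope.
Local Open Scope ring_scope.

(** * Growth rates *)

Section GrowthRate.
Variable R : realType.
Implicit Types (a b : nat -> nat) (s t C : R).

Lemma root_leP s (x : R) n : 0 <= s -> 0 <= x -> (0 < n)%N ->
  (x `^ n%:R^-1 <= s) = (x <= s ^+ n).
Proof.
move=> s0 x0 n0.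
have n0R : (n%:R : R) != 0 by rewrite pnatr_eq0 -lt0n.
have {2}-> : x = (x `^ n%:R^-1) ^+ n.
  by rewrite -powR_mulrn ?powR_ge0// -powRrM mulVf// powRr1.
by rewrite ler_pXn2r ?nnegrE ?powR_ge0// lt0n_neq0.
Qed.

Lemma growth_rate_ge0 a : (0 <= growth_rate R a)%E.
Proof.
apply: limf_esup_ge0 => [F0|n]; last by rewrite lee_fin powR_ge0.
exact: (@filter_not_empty _ (\oo : set_system nat) _ F0).
Qed.

(** The growth rate controls every term, the finitely many exceptions being
    absorbed by the constant. *)
Lemma growth_rate_lt_bound a s : 0 < s -> (growth_rate R a < s%:E)%E ->
  exists2 C, 0 < C & forall n, (a n)%:R <= C * s ^+ n.
Proof.
move=> s0 /ereal_inf_lt[_ [V [N _ NV] <-]] Vs.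
have aN n : (maxn N 1 <= n)%N -> (a n)%:R <= s ^+ n.
  rewrite geq_max => /andP[Nn n0].
  rewrite -root_leP ?ler0n ?(ltW s0)//.
  rewrite -lee_fin; apply: le_trans (ltW Vs).
  by apply: ereal_sup_ubound; exists n => //; apply: NV.
set M := maxn N 1 in aN.
have sum_ge0 (P : pred 'I_M) : 0 <= \sum_(i < M | P i) (a i)%:R / s ^+ i.
  by apply: sumr_ge0 => i _; rewrite divr_ge0// exprn_ge0// ltW.
(* The sum deals with the indices below [M], and the 1 with the others. *)
exists (1 + \sum_(i < M) (a i)%:R / s ^+ i).
  by rewrite ltr_pwDl// sum_ge0.
move=> n; have [nM|Mn] := ltnP n M; last first.
  apply: le_trans (aN n Mn) _; rewrite -{1}[s ^+ n]mul1r ler_wpM2r//.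
    by rewrite exprn_ge0// ltW.
  by rewrite lerDl sum_ge0.
rewrite -ler_pdivrMr ?exprn_gt0//.
rewrite (bigD1 (Ordinal nM))//= addrCA lerDl addr_ge0//.
Qed.

(** By Bernoulli's inequality, [C * n] is eventually at most [(1 + h) ^ (2 * n)]
    for every [h > 0], so a linear factor is invisible to the growth rate. *)
Lemma growth_rate_le_bound a C s : 0 < s ->
  (forall n, (0 < n)%N -> (a n)%:R <= C * n%:R * s ^+ n) ->
  (growth_rate R a <= s%:E)%E.
Proof.
move=> s0 aC; apply/lee_addgt0Pr => d d0.
(* The choice of [h] ensures [s * (1 + h) ^ 2 <= s + d]. *)
pose h := Num.min 1 (d / (3 * s)).
have h0 : 0 < h by rewrite lt_min ltr01 divr_gt0// mulr_gt0.
have h1 : h <= 1 by rewrite ge_min lexx.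
have es : 3 * s * h <= d.
  by rewrite mulrC -ler_pdivlMr ?mulr_gt0// ge_min lexx orbT.
have sd : s * (1 + h) ^+ 2 <= s + d.
  have : 0 <= s * (h * (1 - h)).
    by rewrite !mulr_ge0 ?subr_ge0 ?(ltW s0) ?(ltW h0).
  by rewrite expr2; lra.
apply: ereal_inf_le; eexists.
  exists [set n | (Num.truncn (`|C| / h ^+ 2)).+1 <= n]%N => //.
  by exists (Num.truncn (`|C| / h ^+ 2)).+1.
apply: ge_ereal_sup => _ [n /= Nn <-].
have n0 : (0 < n)%N by case: n Nn.
rewrite -EFinD lee_fin root_leP ?ler0n//; last by rewrite addr_ge0 ?(ltW s0) ?(ltW d0).
apply: le_trans (aC n n0) _.
have Cn : C <= n%:R * h ^+ 2.
  rewrite -ler_pdivrMr ?exprn_gt0//; apply: le_trans (_ : `|C| / h ^+ 2 <= _).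
    by rewrite ler_wpM2r ?ler_norm// invr_ge0 exprn_ge0// ltW.
  by apply/ltW/(lt_le_trans (truncnS_gt _)); rewrite ler_nat.
have ne : n%:R * h <= (1 + h) ^+ n.
  elim: n {Nn n0 Cn} => [|n IH]; first by rewrite mul0r expr0.
  rewrite exprS -natr1 mulrDl mul1r [leRHS]mulrDl mul1r lerD//.
  by rewrite ler_peMr ?exprn_ege1 ?lerDl// ltW.
have ne2 : C * n%:R <= ((1 + h) ^+ 2) ^+ n.
  rewrite exprAC; apply: le_trans (_ : (n%:R * h) ^+ 2 <= _).
    rewrite (_ : (n%:R * h) ^+ 2 = n%:R * h ^+ 2 * n%:R); last by rewrite !expr2; ring.
    by rewrite ler_wpM2r// ler0n.
  by rewrite ler_pXn2r ?nnegrE// ?mulr_ge0 ?ler0n ?exprn_ge0 ?addr_ge0 ?(ltW h0).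
apply: le_trans (_ : (s * (1 + h) ^+ 2) ^+ n <= _).
  by rewrite exprMn mulrC ler_wpM2l// exprn_ge0// ltW.
rewrite lerXn2r ?nnegrE//.
- by rewrite mulr_ge0 ?exprn_ge0 ?addr_ge0 ?(ltW s0) ?(ltW h0).
- by rewrite addr_ge0 ?(ltW s0) ?(ltW d0).
Qed.

(** The form in which cogrowth functions are compared: neither a linear factor
    nor a bounded shift of the argument affects the growth rate. *)
Lemma growth_rate_mono a b k :
  (forall n, (0 < n)%N -> (a n <= n * b (n + k))%N) ->
  (growth_rate R a <= growth_rate R b)%E.
Proof.
move=> ab; rewrite leNgt; apply/negP => ba.
have [t bt ta] : exists2 t, (growth_rate R b < t%:E)%E & (t%:E < growth_rate R a)%E.
  move: (growth_rate R b) (growth_rate R a) ba (growth_rate_ge0 b).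
  move=> [x| |] [y| |]//=.
    rewrite !lte_fin => xy _; exists ((x + y) / 2); rewrite lte_fin; lra.
  by move=> _ _; exists (x + 1); rewrite ?ltry// lte_fin ltrDl.
have t0 : 0 < t by rewrite -lte_fin; apply: le_lt_trans bt; exact: growth_rate_ge0.
have [C C0 bC] := growth_rate_lt_bound t0 bt.
suff /le_lt_trans/(_ ta) : (growth_rate R a <= t%:E)%E by rewrite ltxx.
apply: (@growth_rate_le_bound _ (C * t ^+ k)) => // n n0.
apply: le_trans (_ : (n * b (n + k))%:R <= _); first by rewrite ler_nat ab.
rewrite natrM mulrAC [leLHS]mulrC ler_wpM2r ?ler0n//.
by apply: le_trans (bC _) _; rewrite exprD [t ^+ n * _]mulrC mulrA.
Qed.

End GrowthRate.

(** * Random walks on a group with symmetric letters *)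

Section Walks.
Variables (G : groupType) (X : finType) (e : X -> G).

(** The recursion removes the first letter of a sequence with product [g]. The
    empty sequence is allowed, which makes [walks] a convolution semigroup. *)
Fixpoint walks (n : nat) (g : G) : nat :=
  if n is m.+1 then (\sum_(x : X) walks m ((e x)^-1 * g)%g)%N else (g == 1%g).

Definition symmetric_letters :=
  forall g : G, #|[set x | e x == g]%SET| = #|[set x | e x == (g^-1)%g]%SET|.

Definition letter_product (s : seq X) : G := foldr (fun x h => (e x * h)%g) 1%g s.

(** Removing the last letter instead of the first. *)
Lemma walksSr n g : walks n.+1 g = (\sum_(x : X) walks n (g * (e x)^-1)%g)%N.
Proof.
elim: n g => [|n IH] g.
  by apply: eq_bigr => x _ /=; rewrite divg_eq1 mulg_eq1 (inj_eq invg_inj) eq_sym.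
rewrite [LHS]/=; under eq_bigr => x _ do rewrite -/(walks n.+1 _) IH.
rewrite exchange_big; apply: eq_bigr => x _ /=.
by apply: eq_bigr => y _; rewrite mulgA.
Qed.

Lemma walks_le n g : (walks n g <= #|X| ^ n)%N.
Proof.
elim: n g => [|n IH] g /=; first exact: leq_b1.
rewrite expnS -sum_nat_const; apply: leq_sum => x _; exact: IH.
Qed.

Lemma walks_mul m n g h : (walks m g * walks n h <= walks (m + n) (g * h)%g)%N.
Proof.
elim: m g => [|m IH] g.
  by rewrite /=; case: eqVneq => [->|]; rewrite ?mul0n// mul1n mul1g.
rewrite addSn /= big_distrl /=; apply: leq_sum => x _.
by rewrite mulgA IH.
Qed.

Lemma walks_finite_support n : finite_set [set g | walks n g != 0%N].
Proof.
elim: n => [|n IH].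
  apply: (@sub_finite_set _ _ [set 1%g]); last exact: finite_set1.
  by move=> g /=; case: (eqVneq g 1%g) => [->|].
apply: (@sub_finite_set _ _
  (\bigcup_(x in [set: X]) [set (e x * h)%g | h in [set h | walks n h != 0%N]])).
  move=> g /=; rewrite sum_nat_eq0 negb_forall => /existsP[x /= wx].
  by exists x => //; exists ((e x)^-1 * g)%g; rewrite // mulVKg.
by apply: bigcup_finite => [|x _]; [exact: finite_finset|exact: finite_image].
Qed.

Hypothesis e_sym : symmetric_letters.

(** The letters and their inverses list the same elements of [G] with the same
    multiplicities, even though inversion need not permute the symbols. *)
Lemma sum_lettersV (V : nmodType) (F : G -> V) :
  \sum_(x : X) F (e x) = \sum_(x : X) F ((e x)^-1)%g.
Proof.
rewrite -[LHS](big_map e xpredT F) -[RHS](big_map (fun x => (e x)^-1)%g xpredT F).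
apply: perm_big; apply/allP => g _ /=; rewrite !count_map.
apply/eqP; rewrite -!sum1_count /= !sum1dep_card e_sym.
by apply: eq_card => x; rewrite !inE /= eqg_invLR.
Qed.

Lemma walksV n g : walks n (g^-1)%g = walks n g.
Proof.
elim: n g => [|n IH] g; first by rewrite /= invg_eq1.
rewrite [RHS]walksSr /= (sum_lettersV (fun h => walks n (g * h^-1)%g)).
by apply: eq_bigr => x _; rewrite -invgM IH invgK.
Qed.

Lemma letter_inverse x : exists y, e y = (e x)^-1%g.
Proof.
have : (0 < #|[set y | e y == (e x)^-1%g]%SET|)%N.
  by rewrite -e_sym; apply/card_gt0P; exists x; rewrite inE.
by move=> /card_gt0P[y]; rewrite inE => /eqP; exists y.
Qed.

(** Walks of even length can step forth and back along one letter. *)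
Lemma walks_return_gt0 n : (0 < #|X|)%N -> (0 < walks n.*2 1)%N.
Proof.
move=> /card_gt0P[x _]; elim: n => [|n IH]; first by rewrite /= eqxx.
have [y yx] := letter_inverse x.
rewrite doubleS /= (bigD1 x)//= (bigD1 y)//= yx mulg1 invgK mulgV.
by rewrite -addnA ltn_addr.
Qed.

Section Convolution.
Variable R : realDomainType.
Local Notation f n g := ((walks n g)%:R : R).

Lemma fsum_shift (F : G -> R) (a : G) :
  \sum_(g \in [set: G]) F g = \sum_(g \in [set: G]) F (a * g)%g.
Proof.
by apply: reindex_fsbigT; exists (fun g => a^-1 * g)%g => g; rewrite ?mulKg ?mulVKg.
Qed.

Lemma fsum_finite (D : set G) (F : G -> R) : (forall g, F g != 0 -> D g) ->
  \sum_(g \in D) F g = \sum_(g \in [set: G]) F g.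
Proof.
move=> FD; apply: fsbig_widen => // g [_ Dg] /=.
by apply/eqP/negPn/negP => /FD.
Qed.

Lemma fsum_sum (I : finType) (F : I -> G -> R) :
  (forall i, finite_set [set g | F i g != 0]) ->
  \sum_(g \in [set: G]) \sum_(i : I) F i g =
  \sum_(i : I) \sum_(g \in [set: G]) F i g.
Proof.
move=> Ffin; pose D := \bigcup_(i in [set: I]) [set g | F i g != 0].
have Dfin : finite_set D.
  by apply: bigcup_finite => [|i _]; [exact: finite_finset|exact: Ffin].
rewrite -(@fsum_finite D) => [|g]; last first.
  apply: contra_neqP => Dg; rewrite big1// => i _.
  by apply/eqP/negPn/negP => Fg; apply: Dg; exists i.
rewrite fsbig_finite// exchange_big /=; apply: eq_bigr => i _.
by rewrite -(@fsum_finite D) ?fsbig_finite// => g Fg; exists i.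
Qed.

Lemma finite_shift (D : set G) (a : G) : finite_set D ->
  finite_set [set g | D (a * g)%g].
Proof.
move=> Dfin; apply: sub_finite_set (finite_image (fun g => a^-1 * g)%g Dfin).
move=> g Dg; by exists (a * g)%g; rewrite // mulKg.
Qed.

Lemma walks_shift_finite n (a : G) (F : G -> R) :
  finite_set [set g | f n (a * g)%g * F g != 0].
Proof.
apply: sub_finite_set (finite_shift a (walks_finite_support n)) => g /=.
by apply: contra => /eqP ->; rewrite mul0r.
Qed.

(** Cutting a sequence of [m + n] letters after [m] letters. *)
Lemma walks_convolution m n h :
  \sum_(g \in [set: G]) f m g * f n (g^-1 * h)%g = f (m + n) h.
Proof.
elim: m h => [|m IH] h.
  rewrite -(@fsum_finite [set 1%g]); last first.
    by move=> g /=; case: (eqVneq g 1%g); rewrite ?mul0r ?eqxx.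
  by rewrite fsbig_set1 /= eqxx mul1r invg1 mul1g.
have -> : f (m.+1 + n) h = \sum_(x : X) f (m + n) ((e x)^-1 * h)%g.
  by rewrite addSn /= natr_sum.
transitivity (\sum_(g \in [set: G])
    \sum_(x : X) f m ((e x)^-1 * g)%g * f n (g^-1 * h)%g).
  by apply: eq_fsbigr => g _; rewrite /= natr_sum mulr_suml.
rewrite fsum_sum => [|x]; last exact: walks_shift_finite.
apply: eq_bigr => x _; rewrite (fsum_shift _ (e x)) -IH.
by apply: eq_fsbigr => g _; rewrite mulKg invgM mulgA.
Qed.

Lemma walks_inner n a :
  \sum_(g \in [set: G]) f n g * f n (a^-1 * g)%g = f n.*2 a.
Proof.
rewrite -addnn -walks_convolution; apply: eq_fsbigr => g _.
by rewrite -(walksV _ (g^-1 * a)%g) invgM invgK.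
Qed.

(** The union of the supports of [walks n] and of its translate by [a]. Outside
    this finite set the integrands of the comparison of both functions vanish. *)
Definition pair_support n a : set G :=
  [set g | walks n g != 0%N] `|` [set g | walks n (a^-1 * g)%g != 0%N].

Lemma fsum_pair_support n a (F : G -> R) :
  (forall g, f n g = 0 -> f n (a^-1 * g)%g = 0 -> F g = 0) ->
  \sum_(g \in [set: G]) F g = \sum_(g <- fset_set (pair_support n a)) F g.
Proof.
move=> F0; rewrite -(@fsum_finite (pair_support n a)) => [|g].
  rewrite fsbig_finite// finite_setU; split; first exact: walks_finite_support.
  exact: (finite_shift (D := [set g | walks n g != 0%N]) _ (walks_finite_support n)).
apply: contra_neqP => Dg; apply: F0; apply/eqP; rewrite pnatr_eq0.
  by apply/negPn/negP => W; apply: Dg; left.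
by apply/negPn/negP => W; apply: Dg; right.
Qed.

Lemma walks_norm2 n a :
  \sum_(g <- fset_set (pair_support n a)) f n g ^+ 2 = f n.*2 1%g.
Proof.
rewrite -walks_inner (fsum_pair_support (n := n) (a := a)) => [|g -> _]; last by rewrite mul0r.
by apply: eq_bigr => g _; rewrite invg1 mul1g expr2.
Qed.

Lemma walks_shift_norm2 n a :
  \sum_(g <- fset_set (pair_support n a)) f n (a^-1 * g)%g ^+ 2 = f n.*2 1%g.
Proof.
rewrite -fsum_pair_support => [|g _ ->]; last by rewrite expr0n.
rewrite (fsum_shift _ a) -walks_inner; apply: eq_fsbigr => g _.
by rewrite mulKg invg1 mul1g expr2.
Qed.

(** The squared distance in [l^2(G)] between [walks n] and its translate by [a]:
    both have squared norm [walks (2n) 1], and their inner product is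
    [walks (2n) a]. *)
Lemma walks_dist2 n a :
  \sum_(g <- fset_set (pair_support n a)) (f n g - f n (a^-1 * g)%g) ^+ 2 =
  (f n.*2 1%g - f n.*2 a) *+ 2.
Proof.
under eq_bigr do rewrite sqrrB.
rewrite !big_split /= sumrN sumrMnl walks_norm2 walks_shift_norm2.
rewrite -fsum_pair_support ?walks_inner => [|g -> _]; last by rewrite mul0r.
by ring.
Qed.

End Convolution.

Lemma walks_even_le n a : (walks n.*2 a <= walks n.*2 1)%N.
Proof.
rewrite -(ler_nat int) -subr_ge0 -(pmulrn_lge0 _ (ltn0Sn 1)) -walks_dist2.
by apply: sumr_ge0 => g _; rewrite sqr_ge0.
Qed.

Lemma walks_odd_le n : (walks n.*2.+1 1 <= #|X| * walks n.*2 1)%N.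
Proof.
rewrite -sum_nat_const /=; apply: leq_sum => x _; exact: walks_even_le.
Qed.

End Walks.

(** * Finitely additive integration *)

Section MeanIntegral.
Variables (R : realType) (T : Type) (mu : set T -> R).
Hypothesis mu_ge0 : forall A, 0 <= mu A.
Hypothesis muT : mu setT = 1.
Hypothesis muU : forall A B, A `&` B = set0 -> mu (A `|` B) = mu A + mu B.

Lemma mean_set0 : mu set0 = 0.
Proof.
have := @muU set0 set0; rewrite setI0 setU0 => /(_ erefl) /eqP.
by rewrite -subr_eq0 opprD addrA subrr sub0r oppr_eq0 => /eqP.
Qed.

Lemma mean_fibers (I : finType) (phi : T -> I) (P : pred I) :
  mu [set t | P (phi t)] = \sum_(i | P i) mu [set t | phi t = i].
Proof.
suff H (r : seq I) : uniq r ->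
    mu [set t | phi t \in r] = \sum_(i <- r) mu [set t | phi t = i].
  rewrite -big_enum -H ?enum_uniq//; congr (mu _); apply/seteqP.
  by split=> t /=; rewrite mem_enum.
elim: r => [|i r IH] /=.
  by move=> _; rewrite big_nil -mean_set0; congr (mu _); apply/seteqP; split.
case/andP=> ir /IH {}IH; rewrite big_cons -IH -muU.
  congr (mu _); apply/seteqP; split=> t /=; rewrite inE.
    by case/predU1P; [left|right].
  by case=> [->|->]; rewrite ?eqxx ?orbT.
by apply/seteqP; split=> // t [/= ->]; rewrite (negbTE ir).
Qed.

(** The integral of [k] against the mean. A function with finitely many values
    needs no limit process, and integer values make the bookkeeping a finite sum. *)
Definition mean_integral B (k : T -> 'I_B) : R :=
  \sum_(i < B) i%:R * mu [set t | k t = i].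

(** Over the common refinement of the level sets of the [k j], all these
    functions are integrated by one and the same finite family of weights. *)
Lemma sum_mean_integral (J : finType) B (k : J -> T -> 'I_B) :
  \sum_j mean_integral (k j) =
  \sum_(p : {ffun J -> 'I_B}) (\sum_j (p j)%:R) * mu [set t | [ffun j => k j t] = p].
Proof.
under [RHS]eq_bigr do rewrite mulr_suml.
rewrite [RHS]exchange_big /=; apply: eq_bigr => j _.
rewrite (partition_big (fun p : {ffun J -> 'I_B} => p j) xpredT)//=.
apply: eq_bigr => i _; under eq_bigr => p /eqP -> do [].
rewrite -mulr_sumr -(mean_fibers (fun t => [ffun j => k j t]) (fun p => p j == i)).
congr (_ * mu _); apply/seteqP; split=> t /=; rewrite ffunE; first by move=> ->.
by move/eqP.
Qed.

Lemma sum_fibers (I : finType) (phi : T -> I) :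
  \sum_i mu [set t | phi t = i] = 1.
Proof. by rewrite -(mean_fibers phi xpredT) -muT; congr (mu _); apply/seteqP. Qed.

Lemma mean_integral_le (J : finType) B (k : J -> T -> 'I_B) (C : R) :
  (forall t, \sum_j (k j t)%:R <= C) -> \sum_j mean_integral (k j) <= C.
Proof.
move=> kC; rewrite sum_mean_integral -[C]mulr1.
rewrite -[X in _ <= _ * X](sum_fibers (fun t => [ffun j => k j t])) mulr_sumr.
apply: ler_sum => p _; have [[t /= tp]|/set0P/negP/negPn/eqP ->] :=
  pselect ([set t | [ffun j => k j t] = p] !=set0); last first.
  by rewrite mean_set0 !mulr0.
by rewrite ler_wpM2r// -tp; under eq_bigr do rewrite ffunE.
Qed.

Lemma mean_integral_ge (J : finType) B (k : J -> T -> 'I_B) (C : R) :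
  (forall t, C <= \sum_j (k j t)%:R) -> C <= \sum_j mean_integral (k j).
Proof.
move=> kC; rewrite sum_mean_integral -[C]mulr1.
rewrite -[X in _ * X <= _](sum_fibers (fun t => [ffun j => k j t])) mulr_sumr.
apply: ler_sum => p _; have [[t /= tp]|/set0P/negP/negPn/eqP ->] :=
  pselect ([set t | [ffun j => k j t] = p] !=set0); last first.
  by rewrite mean_set0 !mulr0.
by rewrite ler_wpM2r// -tp; under eq_bigr do rewrite ffunE.
Qed.

End MeanIntegral.

(** * Positive superharmonic functions and amenability *)

Section Green.
Variables (G : groupType) (X : finType) (e : X -> G) (R : realType).
Hypothesis e_gen : forall g, exists n, (0 < walks e n g)%N.
Local Notation f n g := ((walks e n g)%:R : R).

Variables C s t : R.
Hypothesis s_gt0 : 0 < s.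
Hypothesis st : s < t.
Hypothesis walksC : forall n, f n 1%g <= C * s ^+ n.

Let t_gt0 : 0 < t. Proof. exact: lt_trans st. Qed.

(** The Green function of the unnormalised random walk, at [1 / t]. *)
Definition green (g : G) : R := limn (series (fun n => f n g / t ^+ n)).

(** Following a sequence for [g] by a fixed one for [g^-1] bounds the terms by
    those of a geometric series. *)
Lemma green_cvg g : cvgn (series (fun n => f n g / t ^+ n)).
Proof.
have [k wk] := e_gen (g^-1)%g.
have C0 : 0 <= C by have := walksC 0; rewrite expr0 mulr1; apply: le_trans.
apply: (@series_le_cvg _ _ (geometric (C * s ^+ k) (s / t))).
- by move=> n; rewrite divr_ge0 ?ler0n// exprn_ge0// ltW.
- move=> n; rewrite /= mulr_ge0 ?exprn_ge0 ?divr_ge0 ?(ltW s_gt0) ?(ltW t_gt0)//.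
  by rewrite mulr_ge0 ?exprn_ge0 ?(ltW s_gt0).
- move=> n; rewrite /= expr_div_n mulrA ler_wpM2r ?invr_ge0 ?exprn_ge0 ?(ltW t_gt0)//.
  apply: le_trans (_ : f (n + k) 1%g <= _).
    rewrite ler_nat -(mulgV g); apply: leq_trans (walks_mul _ _ _ _ _).
    by rewrite leq_pmulr.
  by apply: le_trans (walksC _) _; rewrite addnC exprD mulrA.
- apply: is_cvg_geometric_series.
  by rewrite ger0_norm ?divr_ge0 ?(ltW s_gt0) ?(ltW t_gt0)// ltr_pdivrMr// mul1r.
Qed.

Lemma green_partial_le g n : series (fun n => f n g / t ^+ n) n <= green g.
Proof.
apply: nondecreasing_cvgn_le; last exact: green_cvg.
apply/nondecreasing_seqP => m; rewrite /series /= big_nat_recr//= lerDl.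
by rewrite divr_ge0 ?ler0n ?exprn_ge0 ?(ltW t_gt0).
Qed.

Lemma green_gt0 g : 0 < green g.
Proof.
have [n wn] := e_gen g; apply: lt_le_trans (green_partial_le g n.+1).
rewrite /series /= big_nat_recr//= ltr_wpDl//.
  by apply: sumr_ge0 => i _; rewrite divr_ge0 ?ler0n ?exprn_ge0 ?(ltW t_gt0).
by rewrite divr_gt0 ?ltr0n ?exprn_gt0.
Qed.

(** Taking one more step multiplies the term of index [n] by [t] and shifts it to
    the index [n + 1]; only the term of index 0 is lost. *)
Lemma green_superharmonic g : \sum_x green ((e x)^-1 * g)%g <= t * green g.
Proof.
have cvgS : \sum_x series (fun n => f n ((e x)^-1 * g)%g / t ^+ n) m @[m --> \oo]
    --> \sum_x green ((e x)^-1 * g)%g.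
  by apply: cvg_big => [|x _]; [exact: add_continuous|exact: green_cvg].
rewrite -(cvg_lim _ cvgS)//; apply: limr_le; first by apply/cvg_ex; eexists; exact: cvgS.
apply: nearW => m; apply: le_trans (_ : t * series (fun n => f n g / t ^+ n) m.+1 <= _); last first.
  by rewrite ler_pM2l// green_partial_le.
rewrite /series /= exchange_big /= big_nat_recl//= mulrDr mulr_sumr.
rewrite ler_wpDl ?mulr_ge0 ?divr_ge0 ?ler0n ?invr_ge0 ?exprn_ge0 ?(ltW t_gt0)//.
apply: ler_sum => i _; rewrite natr_sum -mulr_suml exprS invfM.
by rewrite mulrCA [t * _]mulrA divff ?mul1r// gt_eqF.
Qed.

End Green.

Section AmenableKesten.
Variables (G : groupType) (X : finType) (e : X -> G) (R : realType).
Hypothesis e_sym : symmetric_letters e.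
Hypothesis e_gen : forall g, exists n, (0 < walks e n g)%N.
Hypothesis X_gt0 : (0 < #|X|)%N.

(** On an amenable group, a positive function cannot decrease on average by a
    factor below 1 along the letters: the quotients [q] below pair off into
    mutually inverse numbers, so their mean is at least 1. *)
Lemma superharmonic_amenable (u : G -> R) (t : R) :
  (forall g, 0 < u g) -> 0 < t ->
  (forall g, \sum_x u ((e x)^-1 * g)%g <= t * u g) ->
  amenable R G -> #|X|%:R <= t.
Proof.
move=> u0 t0 ut [mu [mu0 muT muU muG]].
pose q a g := u (a^-1 * g)%g / u g.
have q0 a g : 0 < q a g by rewrite divr_gt0.
have qt g : \sum_x q (e x) g <= t.
  by rewrite -mulr_suml ler_pdivrMr.
have qlet x g : q (e x) g <= t.
  apply: le_trans (qt g); rewrite (bigD1 x)//= lerDl; apply: sumr_ge0 => y _.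
  exact: ltW.
have qinv a g : q a g * q a^-1%g (a^-1 * g)%g = 1.
  by rewrite /q invgK mulVKg mulrA divfK ?divff// gt_eqF.
rewrite leNgt; apply/negP => td.
(* Rounding loses at most 1 for each of the quotients [N * q]; this [N] makes
   the total loss smaller than the gap between [N * t] and [N * #|X|]. *)
have [N Nd] : exists N : nat, #|X|%:R < N%:R * (#|X|%:R - t).
  exists (Num.truncn (#|X|%:R / (#|X|%:R - t))).+1.
  by rewrite -ltr_pdivrMr ?subr_gt0// truncnS_gt.
pose K := Num.truncn (N%:R * t).
pose k a g : 'I_K.+1 := inord (Num.truncn (N%:R * q a g)).
have Nq0 a g : 0 <= N%:R * q a g by rewrite mulr_ge0 ?ler0n ?ltW.
have kE x g : (k (e x) g : nat) = Num.truncn (N%:R * q (e x) g).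
  by rewrite inordK// ltnS le_truncn// ler_wpM2l.
pose Int a := mean_integral mu (k a).
(* Invariance of the mean, for the only functions that are integrated. *)
have IntV a : mean_integral mu (fun g => k a (a * g)%g) = Int a.
  apply: eq_bigr => i _; rewrite -(muG a); congr (_ * mu _).
  apply/seteqP; split=> [_ [g /= <- <-]//|g /= kg].
  by exists (a^-1 * g)%g; rewrite /= mulVKg.
have upper : \sum_x Int (e x) <= N%:R * t.
  apply: mean_integral_le => // g.
  apply: le_trans (_ : \sum_x N%:R * q (e x) g <= _).
    by apply: ler_sum => x _; rewrite kE truncn_le.
  by rewrite -mulr_sumr ler_wpM2l.
(* The sum over [bool] runs over a letter and its inverse. *)
have lower x : 2 * N%:R - 2 <= Int (e x) + Int (e x)^-1%g.
  have [y yx] := letter_inverse e_sym x.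
  pose k2 (b : bool) g := if b then k (e x) g else k (e x)^-1%g ((e x)^-1 * g)%g.
  have := @mean_integral_ge _ _ mu mu0 muT muU _ _ k2 (2 * N%:R - 2).
  rewrite big_bool /= IntV; apply => g; rewrite big_bool /= -yx !kE.
  have [] := (truncnS_gt (N%:R * q (e x) g), truncnS_gt (N%:R * q (e y) (e y * g)%g)).
  rewrite -!natr1 yx; have := qinv (e x) g; have := q0 (e x) g.
  move: (q _ _) (q _ _) => b a a0 ab.
  have : 2 <= a + b.
    have -> : b = a^-1 by apply: (mulfI (lt0r_neq0 a0)); rewrite ab divff ?gt_eqF.
    rewrite -subr_ge0 (_ : _ - _ = (a - 1) ^+ 2 / a) ?divr_ge0 ?sqr_ge0 ?ltW//.
    by field; rewrite gt_eqF.
  move=> /(ler_wpM2l (ler0n R N)); lra.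
have : #|X|%:R * (2 * N%:R - 2) <= \sum_x (Int (e x) + Int (e x)^-1%g).
  rewrite mulr_natl -sumr_const; apply: ler_sum => x _; exact: lower.
rewrite big_split /= -(sum_lettersV e_sym Int) => H; lra.
Qed.

(** Below [#|X|], the growth rate would leave room for a [t < #|X|] at which the
    Green function contradicts [superharmonic_amenable]. *)
Lemma amenable_kesten : amenable R G ->
  growth_rate R (fun n => walks e n 1%g) = (#|X|%:R)%:E.
Proof.
move=> amen; have d0 : 0 < #|X|%:R :> R by rewrite ltr0n.
apply/eqP; rewrite eq_le; apply/andP; split.
  apply: (@growth_rate_le_bound _ _ 1) => // n n0; rewrite mul1r.
  apply: le_trans (_ : #|X|%:R ^+ n <= _); first by rewrite -natrX ler_nat walks_le.
  by rewrite ler_peMl ?exprn_ge0 ?ler0n ?ler1n.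
rewrite leNgt; apply/negP => rate.
have [s [s0 sd rs]] : exists s : R, [/\ 0 < s, s < #|X|%:R &
    (growth_rate R (fun n => walks e n 1%g) < s%:E)%E].
  move: (growth_rate _ _) (growth_rate_ge0 R (fun n => walks e n 1%g)) rate.
  case=> [x| |]//; rewrite lee_fin lte_fin => x0 xd.
  by exists ((x + #|X|%:R) / 2); rewrite lte_fin; split; lra.
have [C _ wC] := growth_rate_lt_bound s0 rs.
pose t := (s + #|X|%:R) / 2.
have st : s < t by rewrite /t; lra.
have t0 : 0 < t by exact: lt_trans st.
have := superharmonic_amenable (green_gt0 e_gen s0 st wC) t0
  (green_superharmonic e_gen s0 st wC) amen.
rewrite /t; lra.
Qed.

End AmenableKesten.

(** * Invariant means from almost invariant vectors *)

Section UltraLimit.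
Variables (R : realType) (U : set_system nat).
Hypothesis UU : UltraFilter U.

Lemma ultra_segment_cvg (q : nat -> R) a b : (forall k, a <= q k <= b) ->
  cvg (q @ U).
Proof.
move=> qab; have PU := @ultra_proper _ _ UU.
have /(_ (q @ U) _) := @segment_compact R a b.
case=> [|p [_ clp]].
  by apply: (@filterE _ U _ (q @^-1` `[a, b])) => k; rewrite /= in_itv /=; exact: qab.
apply/cvg_ex; exists p => V pV.
(* Otherwise [q] eventually avoids [V], and [p] is no cluster point. *)
have [//|UVC] := in_ultra_setVsetC (q @^-1` V) UU.
by have [y []] := clp (~` V) V UVC pV.
Qed.

End UltraLimit.

Section QuasiMean.
Variables (G : groupType) (X : finType) (e : X -> G) (R : realType).
Hypothesis e_sym : symmetric_letters e.
Hypothesis X_gt0 : (0 < #|X|)%N.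
Local Notation f n g := ((walks e n g)%:R : R).

Definition translate (a : G) (A : set G) : set G := (fun x => (a * x)%g) @` A.

Lemma translateM a b A : translate a (translate b A) = translate (a * b)%g A.
Proof.
rewrite /translate image_comp; congr (_ @` A); apply/funext => x.
by rewrite /= mulgA.
Qed.

Lemma translate1 A : translate 1%g A = A.
Proof.
by rewrite /translate (_ : (fun x => _) = id) ?image_id//; apply/funext => x; rewrite mul1g.
Qed.

Lemma in_translate a A g : ((a * g)%g \in translate a A) = (g \in A).
Proof.
apply/idP/idP; rewrite !inE; last by exists g.
by move=> [h Ah] /mulgI <-.
Qed.

(** The probability whose density is the square of the [l^2]-normalised function
    [walks n]. *)
Definition walk_mean n (A : set G) : R :=
  (\sum_(g \in [set: G]) f n g ^+ 2 * (g \in A)%:R) / f n.*2 1%g.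

Local Notation a_ n := (f n.*2 1%g).

Lemma a_gt0 n : 0 < a_ n.
Proof. by rewrite ltr0n walks_return_gt0. Qed.

Lemma walk_meanE n A : walk_mean n A =
  (\sum_(g <- fset_set [set g | walks e n g != 0%N]) f n g ^+ 2 * (g \in A)%:R) / a_ n.
Proof.
congr (_ / _); rewrite -fsbig_finite; last exact: walks_finite_support.
rewrite -(@fsum_finite _ _ [set g | walks e n g != 0%N])// => g /=.
by apply: contra => /eqP ->; rewrite expr0n mul0r.
Qed.

Lemma walk_mean_ge0 n A : 0 <= walk_mean n A.
Proof.
rewrite walk_meanE divr_ge0 ?ler0n//; apply: sumr_ge0 => g _.
by rewrite mulr_ge0 ?sqr_ge0 ?ler0n.
Qed.

Lemma walk_meanT n : walk_mean n setT = 1.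
Proof.
rewrite /walk_mean (eq_fsbigr (fun g => f n g * f n (g^-1 * 1)%g)).
  by rewrite walks_convolution addnn divff// gt_eqF// a_gt0.
by move=> g _; rewrite in_setT mulr1 mulg1 walksV// expr2.
Qed.

Lemma walk_meanU n A B : A `&` B = set0 ->
  walk_mean n (A `|` B) = walk_mean n A + walk_mean n B.
Proof.
move=> AB; rewrite !walk_meanE -mulrDl -big_split /=; congr (_ / _).
apply: eq_bigr => g _; rewrite -mulrDr -natrD in_setU; congr (_ * _%:R).
case: (boolP (g \in A)) => gA; case: (boolP (g \in B)) => gB //.
by move: AB => /seteqP[/(_ g) + _] => /(_ (conj (set_mem gA) (set_mem gB))).
Qed.

Lemma walk_mean_le1 n A : walk_mean n A <= 1.
Proof.
rewrite -(walk_meanT n) -(setUv A) walk_meanU ?setICr//.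
by rewrite lerDl walk_mean_ge0.
Qed.

(** A function almost fixed by [a] in [l^2], as measured by [walks_dist2], has a
    square almost fixed in [l^1]. *)
Lemma walk_mean_translate n (a : G) A (h : R) : 0 < h ->
  a_ n - f n.*2 a <= h ^+ 2 * a_ n ->
  `|walk_mean n (translate a^-1%g A) - walk_mean n A| <= 3 * h.
Proof.
move=> h0 ha; have an0 := a_gt0 n.
pose D := pair_support e n a.
rewrite /walk_mean (fsum_shift _ a^-1%g).
under eq_fsbigr do rewrite in_translate.
rewrite -mulrBl normrM [X in _ * X <= _]gtr0_norm ?invr_gt0// ler_pdivrMr//.
rewrite !(fsum_pair_support (e := e) (n := n) (a := a)) => [|g -> _|g _ ->]; last 2 first.
- by rewrite expr0n mul0r.
- by rewrite expr0n mul0r.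
rewrite -sumrB; apply: le_trans (ler_norm_sum _ _ _) _.
have dist : \sum_(g <- fset_set D) (f n g - f n (a^-1 * g)%g) ^+ 2 <=
    (h ^+ 2 * a_ n) *+ 2.
  by rewrite walks_dist2// lerMn2r/=.
(* For values [p] and [q] of the two functions, [`|q ^ 2 - p ^ 2|] is the product
   of [u = `|q - p|] and [v = `|q + p|], and [2 * u * v <= u ^ 2 / h + h * v ^ 2]. *)
apply: le_trans (_ : \sum_(g <- fset_set D) ((2 * h)^-1 * (f n g - f n (a^-1 * g)%g) ^+ 2
    + h * (f n g ^+ 2 + f n (a^-1 * g)%g ^+ 2)) <= _).
  apply: ler_sum => g _.
  set p := f n g; set q := f n (a^-1 * g)%g.
  rewrite -mulrBl normrM [X in _ * X <= _]ger0_norm ?ler0n//.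
  apply: le_trans (_ : `|q ^+ 2 - p ^+ 2| <= _).
    by rewrite ler_piMr ?normr_ge0// lern1 leq_b1.
  have -> : q ^+ 2 - p ^+ 2 = (q + p) * (q - p) by rewrite !expr2; ring.
  rewrite normrM (_ : (p - q) ^+ 2 = `|q - p| ^+ 2); last first.
    by rewrite real_normK ?num_real// -sqrrN opprB.
  have : `|q + p| ^+ 2 <= 2 * (p ^+ 2 + q ^+ 2).
    rewrite real_normK ?num_real// -subr_ge0.
    by rewrite (_ : _ - _ = (p - q) ^+ 2) ?sqr_ge0// !expr2; ring.
  move: (p ^+ 2 + q ^+ 2) (`|q + p|) (`|q - p|) => S v u.
  rewrite -(ler_pM2l (divr_gt0 h0 (ltr0Sn R 1))) -subr_ge0 => hv.
  rewrite -subr_ge0.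
  have -> : (2 * h)^-1 * u ^+ 2 + h * S - v * u =
      (2 * h)^-1 * (u - h * v) ^+ 2 + (h / 2 * (2 * S) - h / 2 * v ^+ 2).
    by field; rewrite gt_eqF.
  by rewrite addr_ge0// mulr_ge0 ?sqr_ge0// invr_ge0 mulr_ge0// ltW.
rewrite big_split /= -!mulr_sumr big_split /= walks_norm2// walks_shift_norm2//.
have h2 : 0 <= (2 * h)^-1 by rewrite invr_ge0 mulr_ge0// ltW.
have := ler_wpM2l h2 dist.
have -> : (2 * h)^-1 * ((h ^+ 2 * a_ n) *+ 2) = h * a_ n.
  by field; rewrite gt_eqF.
by move=> H; lra.
Qed.

(** Squared norms growing at most like [s ^ (2 * n)] bound the growth of all the
    return numbers, since those of odd index are controlled by their neighbours. *)
Lemma growth_ratio_le (s : R) : 0 < s ->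
  (forall n, a_ n.+1 <= s ^+ 2 * a_ n) ->
  (growth_rate R (fun n => walks e n 1%g) <= s%:E)%E.
Proof.
move=> s0 ratio.
have even n : a_ n <= s ^+ n.*2.
  elim: n => [|n IH]; first by rewrite /= eqxx.
  apply: le_trans (ratio n) _; rewrite doubleS -(addn2 n.*2) addnC exprD.
  by rewrite ler_wpM2l ?sqr_ge0.
apply: (@growth_rate_le_bound _ _ (1 + #|X|%:R / s)) => // n n0.
apply: le_trans (_ : (1 + #|X|%:R / s) * s ^+ n <= _); last first.
  rewrite ler_wpM2r ?exprn_ge0 ?(ltW s0)// ler_peMr ?ler1n//.
  by rewrite addr_ge0 ?divr_ge0 ?ler0n ?(ltW s0).
rewrite -[n]odd_double_half; case: (odd n) => /=; last first.
  rewrite add0n; apply: le_trans (even _) _; rewrite ler_peMl ?exprn_ge0 ?(ltW s0)//.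
  by rewrite lerDl divr_ge0 ?ler0n ?(ltW s0).
rewrite add1n; apply: le_trans (_ : #|X|%:R * s ^+ n./2.*2 <= _).
  apply: le_trans (_ : (#|X| * walks e n./2.*2 1)%:R <= _).
    by rewrite ler_nat walks_odd_le.
  by rewrite natrM ler_wpM2l ?ler0n.
rewrite exprS mulrA ler_wpM2r ?exprn_ge0 ?(ltW s0)// mulrDl divfK ?gt_eqF//.
by rewrite lerDr mul1r ltW.
Qed.

(** Otherwise the ratios would all be at most [s ^ 2] for some [s < #|X|], and the
    growth rate would be at most [s]. *)
Lemma near_maximal_ratio (h : R) : 0 < h ->
  (growth_rate R (fun n => walks e n 1%g) = (#|X|%:R)%:E)%E ->
  exists n, (#|X|%:R ^+ 2 - h) * a_ n <= a_ n.+1.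
Proof.
move=> h0 rate; apply: contrapT => /forallNP H.
have d0 : 0 < #|X|%:R :> R by rewrite ltr0n.
set d : R := #|X|%:R in H d0 rate *.
(* [d ^ 2 - h <= s ^ 2] with [0 < s < d]. *)
pose s := Num.max (d / 2) (d - h / (2 * d)).
have sd : s < d.
  by rewrite gt_max ltr_pdivrMr// ltr_pMr// ltr1n/= ltrBlDr ltrDl divr_gt0// mulr_gt0.
have s0 : 0 < s by rewrite lt_max divr_gt0.
have sh : d ^+ 2 - h <= s ^+ 2.
  have : d - h / (2 * d) <= s by rewrite le_max lexx orbT.
  have -> : d ^+ 2 - h = d ^+ 2 - 2 * d * (h / (2 * d)).
    by field; rewrite gt_eqF.
  move: (h / (2 * d)) => w ws.
  have := sqr_ge0 (d - s).
  have : 2 * d * (d - w) <= 2 * d * s by rewrite ler_wpM2l// mulr_ge0// ltW.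
  rewrite !expr2; lra.
suff : (growth_rate R (fun n => walks e n 1%g) <= s%:E)%E.
  by rewrite rate lee_fin leNgt sd.
apply: growth_ratio_le => // n; apply: ltW; apply: lt_le_trans (_ : (d ^+ 2 - h) * a_ n <= _).
  by rewrite ltNge; apply/negP/H.
by rewrite ler_wpM2r ?ler0n.
Qed.

(** [a_ n.+1] is the sum of [walks (2n)] over all the products of two letters. Each
    of these [#|X| ^ 2] terms is at most [a_ n], so the total defect bounds each
    single one. *)
Lemma ratio_two_letters n x y :
  a_ n - f n.*2 (e x * e y)%g <= #|X|%:R ^+ 2 * a_ n - a_ n.+1.
Proof.
have [x' x'E] := letter_inverse e_sym x; have [y' y'E] := letter_inverse e_sym y.
have split_le (F : X -> nat) x0 m : (forall x, (F x <= m)%N) ->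
    (\sum_x F x + m <= #|X| * m + F x0)%N.
  move=> Fm; rewrite -sum_nat_const (bigD1 x0)//= [in leqRHS](bigD1 x0)//=.
  rewrite addnC -addnA leq_add2l addnC leq_add2r; exact: leq_sum.
have S1 : (walks e n.*2.+2 1 + #|X| * walks e n.*2 1 <=
    #|X| * (#|X| * walks e n.*2 1) + walks e n.*2.+1 (e x))%N.
  have := split_le (fun z => walks e n.*2.+1 ((e z)^-1 * 1)%g) x' (#|X| * walks e n.*2 1)%N.
  rewrite x'E invgK mulg1; apply => z /=.
  by rewrite -sum_nat_const; apply: leq_sum => t _; exact: walks_even_le.
have S2 : (walks e n.*2.+1 (e x) + walks e n.*2 1 <=
    #|X| * walks e n.*2 1 + walks e n.*2 (e x * e y)%g)%N.
  have := split_le (fun z => walks e n.*2 (e x * (e z)^-1)%g) y' (walks e n.*2 1)%N.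
  by rewrite y'E invgK walksSr; apply => z; exact: walks_even_le.
have : (walks e n.+1.*2 1 + walks e n.*2 1 <=
    #|X| * (#|X| * walks e n.*2 1) + walks e n.*2 (e x * e y)%g)%N.
  rewrite doubleS; move: S1 S2; move: (walks e n.*2.+2 1) (walks e n.*2.+1 _).
  by move: (#|X| * (#|X| * _))%N => p; move: (#|X| * _)%N => q u v; lia.
by rewrite -(ler_nat R) !natrD !natrM expr2 => H; lra.
Qed.

(** The products of two letters generate a subgroup [H] of index at most 2, and
    any letter [x0] represents the other coset if there is one. Averaging over
    both cosets turns an [H]-invariant mean into a [G]-invariant one. *)
Lemma amenable_of_invariant (mu : set G -> R) :
  (forall g : G, exists s, letter_product e s = g) ->
  (forall A, 0 <= mu A) -> mu setT = 1 ->
  (forall A B, A `&` B = set0 -> mu (A `|` B) = mu A + mu B) ->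
  (forall x y A, mu (translate (e x * e y)%g A) = mu A) ->
  amenable R G.
Proof.
move=> gen mu0 muT muU muxy; have /card_gt0P[x0 _] := X_gt0.
have mux x A : mu (translate (e x) A) = mu (translate (e x0) A).
  have [z zx] := letter_inverse e_sym x.
  by rewrite -(muxy x0 z) translateM zx mulgVK.
have tT a : translate a setT = setT.
  by apply/seteqP; split => // g _; exists (a^-1 * g)%g; rewrite // mulVKg.
exists (fun A => (mu A + mu (translate (e x0) A)) / 2); split.
- by move=> A; rewrite divr_ge0// addr_ge0.
- by rewrite tT muT; field.
- move=> A B AB; rewrite muU// /translate image_setU muU; first by field.
  apply/seteqP; split => // g [[h Ah <-] [k Bk /mulgI kh]].
  by have : (A `&` B) h; [split=> //; rewrite -kh|rewrite AB].
- move=> g A; rewrite -!/(translate _ _).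
  congr (_ / _); have [s <-] := gen g.
  elim: s => [|x s IH] /=; first by rewrite translate1.
  rewrite -IH -[translate (e x * _)%g A]translateM; move: (translate _ A) => B.
  by rewrite mux addrC translateM muxy.
Qed.

(** The limit mean, taken along an ultrafilter so that it exists on every subset
    of [G], forgets the errors [3 * h k] of [walk_mean_translate]. *)
Lemma kesten_amenable :
  (forall g : G, exists s, letter_product e s = g) ->
  (growth_rate R (fun n => walks e n 1%g) = (#|X|%:R)%:E)%E ->
  amenable R G.
Proof.
move=> gen rate.
pose h (k : nat) : R := k.+1%:R^-1.
have h0 k : 0 < h k by rewrite invr_gt0 ltr0n.
have /choice[n_ nP] : forall k, exists n,
    (#|X|%:R ^+ 2 - h k ^+ 2) * a_ n <= a_ n.+1.
  by move=> k; apply: near_maximal_ratio => //; rewrite exprn_gt0.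
pose q A k := walk_mean (n_ k) A.
have [U [UU leU]] := @ultraFilterLemma _ (\oo : set_system nat) _.
have PU := @ultra_proper _ _ UU.
have cq A : cvg (q A @ U).
  by apply: (@ultra_segment_cvg _ _ UU _ 0 1) => k; rewrite walk_mean_ge0 walk_mean_le1.
have limq A (l : R) : q A @ U --> l -> lim (q A @ U) = l by apply: cvg_lim.
apply: (@amenable_of_invariant (fun A => lim (q A @ U))) => //.
- move=> A; apply: limr_ge; first exact: cq.
  by apply: filterE => k; exact: walk_mean_ge0.
- apply: limq; have -> : q setT = cst 1 by apply/funext => k; exact: walk_meanT.
  exact: cvg_cst.
- move=> A B AB; apply: limq.
  have -> : q (A `|` B) = (fun k => q A k + q B k).
    by apply/funext => k; exact: walk_meanU.
  exact: cvgD (cq A) (cq B).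
- move=> x y A; apply: limq.
  have [x' x'E] := letter_inverse e_sym x; have [y' y'E] := letter_inverse e_sym y.
  set B := translate _ A.
  have -> : q B = (fun k => q A k + (q B k - q A k)) by apply/funext => k; rewrite addrC subrK.
  rewrite -[lim _]addr0; apply: cvgD; first exact: cq.
  apply: norm_cvg0; apply: (@squeeze_cvgr _ _ _ _ (cst 0) (fun k => 3 * h k)).
  + apply: filterE => k; rewrite normr_ge0 /=.
    rewrite /B (_ : (e x * e y)%g = (e y' * e x')^-1)%g; last first.
      by rewrite invgM x'E y'E !invgK.
    apply: walk_mean_translate => //.
    apply: le_trans (ratio_two_letters _ _ _) _.
    by have := nP k; rewrite mulrBl; lra.
  + exact: cvg_cst.
  + apply: (cvg_trans (G := (fun k => 3 * h k) @ \oo)); last first.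
      rewrite -[0](mulr0 3); apply: cvgM; first exact: cvg_cst.
      exact: cvg_harmonic.
    by move=> V /leU.
Qed.

End QuasiMean.

(** * Counting words *)

Section Counting.

Lemma card_fset_set_seq (T : choiceType) (A : set T) (l : seq T) :
  uniq l -> (forall x, A x <-> x \in l) -> #|` fset_set A|%fset = size l.
Proof.
move=> ul Al; have -> : A = [set` [fset x in l]%fset].
  by apply/seteqP; split=> x /=; rewrite inE => /Al.
by rewrite set_fsetK card_fseq undup_id.
Qed.

Fixpoint seqs (X : finType) n : seq (seq X) :=
  if n is m.+1 then [seq x :: s | x <- enum X, s <- seqs X m] else [:: [::]].

Lemma mem_seqs (X : finType) n s : (s \in seqs X n) = (size s == n).
Proof.
elim: n s => [|n IH] s /=; first by rewrite inE size_eq0.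
apply/allpairsP/idP => [[[x s'] [_ /= + ->]]|]; first by rewrite IH eqSS.
case: s => // x s /=; rewrite eqSS -IH => ss.
by exists (x, s); rewrite mem_enum.
Qed.

Lemma seqs_uniq (X : finType) n : uniq (seqs X n).
Proof.
elim: n => //= n IH; apply: allpairs_uniq => //; first exact: enum_uniq.
by move=> [x s] [y r] _ _ [-> ->].
Qed.

(** [insub] drops the empty sequence, so that [words X 0] is empty. *)
Definition words (X : finType) n : seq (word X) := pmap insub (seqs X n).

Lemma mem_words (X : finType) n (w : word X) : (w \in words X n) = (size w == n).
Proof. by rewrite mem_pmap_sub mem_seqs. Qed.

Lemma words_uniq (X : finType) n : uniq (words X n).
Proof. exact/pmap_sub_uniq/seqs_uniq. Qed.

Lemma perm_words (X : finType) n : (0 < n)%N ->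
  perm_eq [seq letters w | w <- words X n] (seqs X n).
Proof.
move=> n0; apply: uniq_perm; rewrite ?seqs_uniq ?map_inj_uniq ?words_uniq//.
  exact: val_inj.
move=> s; rewrite mem_seqs; apply/mapP/idP => [[w + ->]|sn]; first by rewrite mem_words.
have s0 : s != [::] by case: s sn => // /eqP nE; rewrite -nE in n0.
by exists (Word s0); rewrite // mem_words.
Qed.

Variables (G : groupType) (X : finType) (ev : {multiplicative word X -> G}).

Definition letter_value (x : X) : G := ev (letter x).
Local Notation e := letter_value.

Lemma word_value (w : word X) : ev w = letter_product e (letters w).
Proof.
case: w => s; elim: s => [//|x s IH] s0; case: s IH s0 => [|y s] IH s0.
  by rewrite /= mulg1; congr (ev _); apply/val_inj.
have -> : Word s0 = (letter x * (Word (isT : y :: s != [::])))%g.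
  exact/val_inj.
by rewrite gmulfM IH.
Qed.

(** Splitting off the first [k] letters, given explicitly as a sequence. *)
Lemma sum_seqs_walks k m h :
  (\sum_(s <- seqs X k) walks e m ((letter_product e s)^-1 * h)%g = walks e (k + m) h)%N.
Proof.
elim: k h => [|k IH] h.
  by rewrite big_seq1 /= invg1 mul1g.
rewrite [seqs _ _]/= big_allpairs_dep big_enum /=; apply: eq_bigr => x _.
by rewrite -IH; apply: eq_bigr => s _; rewrite invgM mulgA.
Qed.

Lemma count_words n g : (0 < n)%N ->
  count (fun w => ev w == g) (words X n) = walks e n g.
Proof.
move=> n0; rewrite -[n in RHS]addn0 -sum_seqs_walks -(perm_big _ (perm_words X n0)) /=.
rewrite big_map -sum1_count big_mkcond; apply: eq_bigr => w _ /=.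
by rewrite -word_value mulg_eq1 (inj_eq invg_inj); case: eqP.
Qed.

Lemma local_cogrowthE g n : (0 < n)%N -> local_cogrowth ev g n = walks e n g.
Proof.
move=> n0; rewrite -count_words// -size_filter; apply: card_fset_set_seq.
  exact/filter_uniq/words_uniq.
move=> w; rewrite mem_filter mem_words; split; first by case=> -> ->; rewrite !eqxx.
by case/andP=> /eqP ? /eqP.
Qed.

Hypothesis ev_sym : symmetric_choice ev.

Lemma letter_value_sym : symmetric_letters e. Proof. exact: ev_sym. Qed.

(** Fix the length [k] of [u] between 1 and [n.-1]. The words [v] of length [n - k]
    with the value of [u] are as many as those with the inverse value, and the
    latter are those that complete [u] to a word representing [1]. *)
Lemma global_cogrowthE n : global_cogrowth ev n = (n.-1 * walks e n 1)%N.
Proof.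
pose pairs k := [seq (u, v) | u <- words X k, v <- [seq v <- words X (n - k) | ev v == ev u]].
have size_pairs k : k \in iota 1 n.-1 -> size (pairs k) = walks e n 1.
  rewrite mem_iota => kn; rewrite size_allpairs_dep sumnE big_map.
  have kn' : (0 < k < n)%N by clear -kn; case: n kn => /=; lia.
  transitivity (\sum_(u <- words X k) walks e (n - k) (ev u))%N.
    by apply: eq_bigr => u _; rewrite size_filter count_words//; lia.
  rewrite -[in RHS](subnKC (_ : k <= n)%N) -?sum_seqs_walks; last by lia.
  rewrite -(perm_big _ (perm_words X (_ : 0 < k)%N)) /=; last by lia.
  rewrite big_map; apply: eq_bigr => u _.
  by rewrite -word_value mulg1 walksV//; exact: letter_value_sym.
rewrite /global_cogrowth (@card_fset_set_seq _ _ [seq p | k <- iota 1 n.-1, p <- pairs k]).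
- rewrite size_allpairs_dep sumnE big_map (eq_big_seq (fun=> walks e n 1%g))//.
  by rewrite big_const_seq count_predT size_iota iter_addn_0 mulnC.
- apply: allpairs_uniq_dep => [|k _|]; first exact: iota_uniq.
    apply: allpairs_uniq_dep => [|u _|]; first exact: words_uniq.
      exact/filter_uniq/words_uniq.
    by move=> [u v] [u' v'] _ _ /= [-> ->].
  (* The first component of a pair in [pairs k] has length [k]. *)
  have len (kp : {_ : nat & (word X * word X)%type}) :
      kp \in [seq @Tagged _ k (fun=> (word X * word X)%type) p | k <- iota 1 n.-1, p <- pairs k] ->
      size (tagged kp).1 = tag kp.
    case/allpairsPdep=> k [_ [_ /allpairsPdep[u [v [+ _ ->]]] ->]] /=.
    by rewrite mem_words => /eqP.
  move=> [k p] [k' p'] /len /= kE /len /= kE' pp.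
  by move: kE kE'; rewrite pp => -> <-.
- move=> [u v]; have sizew (w : word X) : (0 < size w)%N by case: w => -[].
  split=> /= [[uvn evuv]|].
    apply/allpairsPdep; exists (size u), (u, v); split=> //.
      move: (sizew u) (sizew v) uvn; rewrite mem_iota.
      by move: (size u) (size v) => i j; clear; lia.
    apply/allpairsPdep; exists u, v; rewrite mem_filter !mem_words evuv !eqxx.
    by rewrite -uvn addKn eqxx.
  case/allpairsPdep=> k [_ [+ /allpairsPdep[u' [v' [+ + ->]]] [-> ->]]].
  rewrite mem_filter !mem_words mem_iota => kn /eqP uk /andP[/eqP evv /eqP vk].
  by split=> //=; rewrite uk vk; move: kn; clear; lia.
Qed.

End Counting.

(** * The criterion *)

Theorem theorem6p3 (R : realType) (G : groupType) (X : finType)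
    (ev : {multiplicative word X -> G})
    (ev_surj : forall g : G, exists w : word X, ev w = g)
    (ev_sym : symmetric_choice ev) :
  [<-> amenable R G;
       global_cogrowth_rate R ev = (#|X|%:R%R)%:E;
       exists g : G, local_cogrowth_rate R ev g = (#|X|%:R%R)%:E;
       forall g : G, local_cogrowth_rate R ev g = (#|X|%:R%R)%:E].
Proof.
pose e := letter_value ev; have e_sym : symmetric_letters e := letter_value_sym ev_sym.
have gen g : exists k, (0 < walks e k g)%N.
  have [w <-] := ev_surj g; exists (size w); rewrite -count_words.
    by rewrite -has_count; apply/hasP; exists w; rewrite ?mem_words.
  by case: w => -[].
have X_gt0 : (0 < #|X|)%N.
  have [w _] := ev_surj 1%g; apply/card_gt0P.
  by case: w => -[//|x s] _; exists x.
pose rate := growth_rate R (fun n => walks e n 1%g).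
have globalE : global_cogrowth_rate R ev = rate.
  apply/eqP; rewrite eq_le; apply/andP; split.
    apply: (@growth_rate_mono _ _ _ 0) => n n0.
    by rewrite global_cogrowthE// addn0 leq_mul// leq_pred.
  (* The shift by 2 keeps the factor [(n + 2).-1] positive. *)
  apply: (@growth_rate_mono _ _ _ 2) => n n0.
  rewrite global_cogrowthE// mulnA.
  have /leq_trans-> // : (walks e n 1 <= walks e (n + 2) 1)%N.
    rewrite -[in leqRHS](mulg1 1%g); apply: leq_trans (walks_mul _ _ _ _ _).
    by rewrite leq_pmulr// (walks_return_gt0 e_sym 1).
  by rewrite leq_pmull// muln_gt0 n0 addn2.
have localE g : local_cogrowth_rate R ev g = rate.
  apply/eqP; rewrite eq_le; apply/andP; split.
    have [k wk] := gen (g^-1)%g; apply: (@growth_rate_mono _ _ _ k) => n n0.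
    rewrite local_cogrowthE// -(mulgV g).
    apply: leq_trans (leq_mul n0 (walks_mul _ _ _ _ _)).
    by rewrite mul1n leq_pmulr.
  have [k wk] := gen g; apply: (@growth_rate_mono _ _ _ k) => n n0.
  rewrite local_cogrowthE ?addn_gt0 ?n0// -(mul1g g).
  apply: leq_trans (leq_mul n0 (walks_mul _ _ _ _ _)).
  by rewrite mul1n leq_pmulr.
split; [|split; [|split]].
- by rewrite globalE; exact: amenable_kesten.
- by rewrite globalE => rateE; exists 1%g; rewrite localE.
- by case=> g; rewrite localE => rateE h; rewrite localE.
- move=> /(_ 1%g); rewrite localE; apply: kesten_amenable => // g.
  by have [w <-] := ev_surj g; exists (letters w); rewrite -word_value.
Qed.
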